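(* Let $(a,b)\in\mathcal H_{\mathrm{II}}^+$ and $\phi=\phi_{a,b}$. Then $J(\phi)$ is an attractor for $\phi$, with basin of attraction containing $B_1(0,0)$.
   Context: $K$ is a field complete and locally compact with respect to a nontrivial non-Archimedean absolute value $|\cdot|$, whose residue field has odd characteristic. $\|(x,y)\|=\max(|x|,|y|)$, $B_1(0,0)=\{\|(x,y)\|\le1\}$. $\phi_{a,b}(x,y)=(a+by-x^2,x)$ for $b\ne0$, a homeomorphism of $K^2$ with inverse $(x,y)\mapsto(y,\frac1b(-a+x+y^2))$. $J(\phi)$ is the set of points whose two-sided orbit $\{\phi^n(x,y):n\in\mathbb Z\}$ is bounded. $\mathcal H_{\mathrm{II}}^+=\{(a,b):|a|\le1,0<|b|<1\}$. For a homeomorphism $\phi$ of a metric space $(M,d)$, an attractor is a set $\mathcal A\subseteq M$ that is nonempty, compact, satisfies $\phi(\mathcal A)=\mathcal A$, and for which there exists an open set $U$ properly containing $\mathcal A$ with $\lim_{n\to+\infty}\min_{\alpha\in\mathcal A}d(\phi^n(\beta),\alpha)=0$ for all $\beta\in U$; the union of all such $U$ is the basin of attraction. *)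

(* Defs.v *)
From HB Require Import structures.
From mathcomp Require Import all_boot all_order all_algebra.
From mathcomp Require Import ring_quotient.
From mathcomp Require Import ring.
From mathcomp Require Import all_classical all_reals all_analysis.

Set Implicit Arguments.
Unset Strict Implicit.
Unset Printing Implicit Defensive.

Import Order.TTheory GRing.Theory Num.Theory.
Import numFieldNormedType.Exports.

Local Open Scope classical_set_scope.
Local Open Scope ring_scope.

(* The norm [`| _ |] of a [normedZmodType] satisfies [`|x *+ n| = `|x| *+ n],
   which fails for every non-Archimedean absolute value; hence this record. *)
Record nonArchAbs (R : realType) (K : fieldType) := NonArchAbs {
  absv :> K -> R ;
  absv_ge0 : forall x, 0 <= absv x ;
  absv_eq0 : forall x, (absv x == 0) = (x == 0) ;
  absvM : forall x y, absv (x * y) = absv x * absv y ;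
  absv_ultra : forall x y, absv (x + y) <= Num.max (absv x) (absv y)
}.

Section AbsTheory.
Variables (R : realType) (K : fieldType) (v : nonArchAbs R K).

Lemma absv0 : v 0 = 0.
Proof. by apply/eqP; rewrite absv_eq0. Qed.

Lemma absv1 : v 1 = 1.
Proof.
have v1 : v 1 != 0 by rewrite absv_eq0 oner_eq0.
by apply: (mulfI v1); rewrite -absvM !mulr1.
Qed.

Lemma absvN1 : v (- 1) = 1.
Proof.
have : v (- 1) ^+ 2 == 1 by rewrite expr2 -absvM mulrNN mulr1 absv1.
by rewrite sqrp_eq1 ?absv_ge0// => /eqP.
Qed.

Lemma absvN x : v (- x) = v x.
Proof. by rewrite -mulN1r absvM absvN1 mul1r. Qed.

Lemma absvV x : v x^-1 = (v x)^-1.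
Proof.
have [->|x0] := eqVneq x 0; first by rewrite invr0 absv0 invr0.
have vx0 : v x != 0 by rewrite absv_eq0.
by apply: (mulfI vx0); rewrite -absvM !divff// absv1.
Qed.

End AbsTheory.

(* [K] with the topology and metric defined by the absolute value. *)
Definition valued (R : realType) (K : fieldType) (_ : nonArchAbs R K) : Type :=
  K.

Section ValuedMetric.
Variables (R : realType) (K : fieldType) (v : nonArchAbs R K).
Local Notation valued := (valued v).

HB.instance Definition _ := GRing.Field.on valued.
HB.instance Definition _ := isPointed.Build valued 0.

Definition valued_dist (x y : valued) : R := v (x - y : K).

Lemma valued_distxx x : valued_dist x x = 0.
Proof. by rewrite /valued_dist subrr absv0. Qed.

Lemma valued_dist_positivity x y : valued_dist x y = 0 -> x = y.
Proof. by move=> /eqP; rewrite absv_eq0 subr_eq0 => /eqP. Qed.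

Lemma valued_dist_sym x y : valued_dist x y = valued_dist y x.
Proof. by rewrite /valued_dist -opprB absvN. Qed.

Lemma valued_dist_triangle y x z :
  valued_dist x z <= valued_dist x y + valued_dist y z.
Proof.
have -> : valued_dist x z = v ((x - y) + (y - z)) by rewrite addrA subrK.
apply: (le_trans (absv_ultra _ _ _)).
by rewrite ge_max lerDl lerDr !absv_ge0.
Qed.

HB.instance Definition _ := @isMetric.Build R valued valued_dist
  valued_distxx valued_dist_positivity valued_dist_sym valued_dist_triangle.

Definition nontrivial_abs := exists2 x : K, x != 0 & v x != 1.

Definition complete_abs :=
  forall F : set_system valued, ProperFilter F -> cauchy F -> cvg F.

Definition locally_compact_abs := locally_compact [set: valued].

End ValuedMetric.

Section ProductMetric.
Variables (R : realType) (U V : metricType R).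

Let dist (p q : U * V) : R := Num.max (mdist p.1 q.1) (mdist p.2 q.2).

Let dist_ge0 p q : 0 <= dist p q.
Proof. by rewrite le_max mdist_ge0. Qed.

Let dist_positivity p q : dist p q = 0 -> p = q.
Proof.
case: p q => [x y] [x' y'] /= d0.
have : dist (x, y) (x', y') <= 0 by rewrite d0.
rewrite ge_max /= => /andP[h1 h2].
congr (_, _); apply: mdist_positivity; apply/eqP.
  by rewrite eq_le h1 mdist_ge0.
by rewrite eq_le h2 mdist_ge0.
Qed.

Let ballE p d : ball p d = [set q | dist p q < d].
Proof.
rewrite {1}/ball /= /prod_ball !ballEmdist.
by apply/seteqP; split => q /=; rewrite /dist gt_max => /andP.
Qed.

HB.instance Definition _ := @PseudoMetric_isMetric.Build R (U * V)%type
  dist dist_ge0 dist_positivity ballE.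

End ProductMetric.

Section ResidueField.
Local Open Scope quotient_scope.
Variables (R : realType) (K : fieldType) (v : nonArchAbs R K).

Definition val_ring_pred : pred K := fun x => v x <= 1.

Lemma val_ring_subring : subring_closed val_ring_pred.
Proof.
have E x : (x \in val_ring_pred) = (v x <= 1) by [].
split=> [|x y|x y]; rewrite !E ?absv1// => x1 y1.
  by rewrite (le_trans (absv_ultra _ _ _))// ge_max absvN x1.
by rewrite absvM mulr_ile1 ?absv_ge0.
Qed.

HB.instance Definition _ :=
  GRing.isSubringClosed.Build K val_ring_pred val_ring_subring.

Record val_ring := ValRing {
  val_ring_val :> K ;
  val_ringP : val_ring_val \in val_ring_pred
}.

HB.instance Definition _ := [isSub for val_ring_val].
HB.instance Definition _ := [Choice of val_ring by <:].
HB.instance Definition _ := [SubChoice_isSubComNzRing of val_ring by <:].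

Definition max_ideal : {pred val_ring} := fun x => v (val x) < 1.

Lemma max_idealP : idealr_closed max_ideal.
Proof.
have E x : (x \in max_ideal) = (v (val x) < 1) by [].
split=> [||a x y]; rewrite !E ?raddf0 ?rmorph1 ?absv0 ?absv1 ?ltr01 ?ltxx//.
move=> x1 y1; rewrite rmorphD rmorphM.
rewrite (le_lt_trans (absv_ultra _ _ _))// gt_max y1 andbT absvM.
by rewrite (le_lt_trans _ x1)// ler_piMl ?absv_ge0//; exact: (valP a).
Qed.

HB.instance Definition _ := isIdealr.Build val_ring max_ideal max_idealP.

Definition residue_field := {ideal_quot max_ideal : idealr val_ring}.

HB.instance Definition _ := EqQuotient.on residue_field.
HB.instance Definition _ := GRing.ComNzRing.on residue_field.
HB.instance Definition _ := ZmodQuotient.on residue_field.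
HB.instance Definition _ := NzRingQuotient.on residue_field.

Definition residue_inv (x : residue_field) : residue_field :=
  \pi_residue_field (insubd (0 : val_ring) (val (repr x))^-1).

Lemma residue_eq0 (y : val_ring) :
  (\pi_residue_field y == 0) = (v (val y) < 1).
Proof. by rewrite -(rmorph0 \pi_residue_field) -Quotient.idealrBE subr0. Qed.

Lemma residue_mulVf (x : residue_field) : x != 0 -> residue_inv x * x = 1.
Proof.
rewrite /residue_inv -{1 3}[x]reprK residue_eq0; set y := repr x => y1.
have y_le1 : v (val y) <= 1 := valP y.
have vy1 : v (val y) = 1 by apply/eqP; rewrite eq_le y_le1/= leNgt.
have yV : (val y)^-1 \in val_ring_pred.
  by rewrite /in_mem /= /val_ring_pred absvV vy1 invr1.
rewrite -rmorphM -[RHS](rmorph1 \pi_residue_field).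
congr (\pi_residue_field _).
apply: val_inj; rewrite rmorphM rmorph1 /= insubdK// mulVf//.
by rewrite -(absv_eq0 v) vy1 oner_eq0.
Qed.

Lemma residue_inv0 : residue_inv 0 = 0.
Proof.
have : \pi_residue_field (repr (0 : residue_field)) == 0 by rewrite reprK.
rewrite residue_eq0 /residue_inv; set y := repr _ => y1.
apply/eqP; rewrite residue_eq0 val_insubd; case: ifP => [|_]; last first.
  by rewrite raddf0 absv0 ltr01.
rewrite /in_mem /= /val_ring_pred absvV => yV1.
have [->|vy0] := eqVneq (v (val y)) 0; first by rewrite invr0 ltr01.
have vy_gt0 : 0 < v (val y) by rewrite lt_neqAle eq_sym vy0 absv_ge0.
by move: yV1; rewrite invf_le1// leNgt y1.
Qed.

HB.instance Definition _ :=
  GRing.ComNzRing_isField.Build residue_field residue_mulVf residue_inv0.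

End ResidueField.

Section Attractor.
Variables (R : realType) (M : metricType R).

(* For [A] nonempty and compact the infimum is a minimum. *)
Definition dist_to_set (A : set M) (x : M) : R :=
  inf [set mdist x alpha | alpha in A].

Definition attracted_nbhd (f : M -> M) (A U : set M) :=
  [/\ open U, A `<` U &
      forall beta, U beta ->
        dist_to_set A (iter n f beta) @[n --> \oo] --> (0 : R)].

Definition is_attractor (f : M -> M) (A : set M) :=
  [/\ A !=set0, compact A, f @` A = A & exists U, attracted_nbhd f A U].

Definition basin (f : M -> M) (A : set M) : set M :=
  \bigcup_(U in attracted_nbhd f A) U.

End Attractor.

(* The integer iterates of [f], where [g] is the inverse of [f]. *)
Definition iterz (T : Type) (f g : T -> T) (n : int) : T -> T :=
  match n with
  | Posz m => iter m f
  | Negz m => iter m.+1 g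
  end.

Section Henon.
Variables (R : realType) (K : fieldType) (v : nonArchAbs R K).

Definition plane : Type := (valued v * valued v)%type.

HB.instance Definition _ := Metric.copy plane (valued v * valued v)%type.

Definition plane_norm (z : plane) : R := Num.max (v z.1) (v z.2).

Lemma plane_mdistE (p q : plane) :
  mdist p q = plane_norm (p.1 - q.1, p.2 - q.2).
Proof. by []. Qed.

Definition unit_ball : set plane := [set z | plane_norm z <= 1].

Definition plane_bounded (A : set plane) :=
  exists C : R, forall z, A z -> plane_norm z <= C.

Variables (a b : K).

Definition henon (z : plane) : plane := (a + b * z.2 - z.1 ^+ 2, z.1).

Definition henon_inv (z : plane) : plane :=
  (z.2, b^-1 * (- a + z.1 + z.2 ^+ 2)).

Lemma henonK : b != 0 -> cancel henon henon_inv.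
Proof.
move=> b0 [x y]; rewrite /henon /henon_inv /=; congr (_, _).
suff -> : - a + (a + b * y - x ^+ 2) + x ^+ 2 = b * y :> K by rewrite mulKf.
by ring.
Qed.

Lemma henon_invK : b != 0 -> cancel henon_inv henon.
Proof.
move=> b0 [x y]; rewrite /henon /henon_inv /=; congr (_, _).
rewrite mulVKf//; suff : a + (- a + x + y ^+ 2) - y ^+ 2 = x :> K by [].
by ring.
Qed.

Definition henon_orbit (z : plane) : set plane :=
  range (fun n : int => iterz henon henon_inv n z).

Definition henon_J : set plane := [set z | plane_bounded (henon_orbit z)].

Definition H_II_plus := v a <= 1 /\ 0 < v b < 1.

End Henon.

Arguments henon {R K} v a b z.
Arguments henon_inv {R K} v a b z.
Arguments henon_orbit {R K} v a b z.
Arguments henon_J {R K} v a b.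
Arguments unit_ball {R K} v z : rename.

(* Main.v *)
(* The unit ball B is compact, open, and mapped into itself by the Henon map
   phi.  Outside B a point escapes to infinity in forward time if |x| >= |y|,
   and in backward time otherwise, so J is the decreasing intersection of the
   phi^n(B).  As phi is nonexpansive on B, these sets are compact, and hence
   they eventually enter every neighborhood of J.  The intersection is proper
   because |b| < 1 prevents phi(B) from filling B. *)
Require Import Defs.
From mathcomp Require Import all_boot all_order all_algebra.
From mathcomp Require Import ring.
From mathcomp Require Import all_classical all_reals all_analysis.

Import Order.TTheory GRing.Theory Num.Theory.
Import numFieldNormedType.Exports.

Local Open Scope classical_set_scope.
Local Open Scope ring_scope.

(** * Metric and compactness preliminaries *)

Lemma lipschitz_within_continuous {R : realType} {M N : metricType R}
    (f : M -> N) (A : set M) (k : R) : 0 < k ->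
  (forall x y, A x -> A y -> mdist (f x) (f y) <= k * mdist x y) ->
  {within A, continuous f}.
Proof.
move=> k0 flip; apply/subspace_continuousP => x Ax; apply/cvg_ballP => e e0.
rewrite /within /=; apply/nbhs_ballP; exists (e / k) => [|y].
  exact: divr_gt0.
rewrite !ballEmdist /= => xy Ay.
by rewrite (le_lt_trans (flip _ _ Ax Ay))// mulrC -ltr_pdivlMr.
Qed.

(** A point of [B] either lies in [U] or is missed by some [F N], hence has a neighborhood missed by
    every later [F n]. Compactness of [B] makes the index uniform. *)
Lemma compact_bigcap_sub_near {T : topologicalType} (B U : set T)
    (F : nat -> set T) :
  compact B -> open U -> (forall n, F n `<=` B) -> (forall n, closed (F n)) ->
  (forall m n, (m <= n)%N -> F n `<=` F m) ->
  \bigcap_n F n `<=` U -> \forall n \near \oo, F n `<=` U.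
Proof.
move=> /compact_near_coveringP cB oU FB Fcl Fdec FU.
have : \forall n \near \oo, B `<=` [set x | F n x -> U x].
  apply: (cB _ _ (fun n x => F n x -> U x)) => x Bx.
  have [Ux|nUx] := pselect (U x).
    exists (U, setT) => /=; first by split; [exact: open_nbhs_nbhs|exact: filterT].
    by move=> [y n] [].
  have [N NFx] : exists N, ~ F N x.
    by apply/existsNP => Fx; apply: nUx; apply: FU => n _; exact: Fx.
  exists (~` F N, [set n | (N <= n)%N]) => /=.
    split; last exact: nbhs_infty_ge.
    by apply: open_nbhs_nbhs; split=> //; exact/closed_openC.
  by move=> [y n] [/= nFy Nn] /(Fdec _ _ Nn).
by apply: filterS => n BFU x Fx; apply: BFU => //; exact: FB Fx.
Qed.

Lemma dist_to_set_lt_near {R : realType} {M : metricType R} (A : set M)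
    (e : R) (x : M) :
  0 < e -> A x -> forall y, ball x e y -> dist_to_set A y < e.
Proof.
move=> e0 Ax y; rewrite ballEmdist /= metric_sym => yx.
apply: le_lt_trans yx; apply: ge_inf; last by exists x.
by exists 0 => _ [z _ <-]; exact: mdist_ge0.
Qed.

Lemma dist_to_set_ge0 {R : realType} {M : metricType R} (A : set M) (x : M) :
  A !=set0 -> 0 <= dist_to_set A x.
Proof.
move=> [z Az]; apply: lb_le_inf; first by exists (mdist x z), z.
by move=> _ [w _ <-]; exact: mdist_ge0.
Qed.

(** * Nonexpansive self-maps of a compact set *)

Section TrappingRegion.
Variables (R : realType) (M : metricType R) (f : M -> M) (B : set M).
Hypotheses (B_compact : compact B) (B_neq0 : B !=set0).
Hypothesis fB : forall x, B x -> B (f x).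
Hypothesis f_nonexpansive :
  forall x y, B x -> B y -> mdist (f x) (f y) <= mdist x y.

Let F n := iter n f @` B.

Lemma trapped_iter n x : B x -> B (iter n f x).
Proof. by move=> Bx; elim: n => //= n; exact: fB. Qed.

(** Iterates are nonexpansive on [B], hence continuous within [B], so [F n] is compact in a
    Hausdorff space. *)
Lemma trapped_image_closed n : closed (F n).
Proof.
apply: compact_closed; first exact: metric_hausdorff.
apply: continuous_compact => //.
apply: (@lipschitz_within_continuous _ _ _ _ _ 1) => // x y Bx By.
rewrite mul1r; elim: n => //= n; apply: le_trans.
by apply: f_nonexpansive; exact: trapped_iter.
Qed.

Lemma trapped_image_sub n : F n `<=` B.
Proof. by move=> _ [x Bx <-]; exact: trapped_iter. Qed.

Lemma trapped_image_decr m n : (m <= n)%N -> F n `<=` F m.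
Proof.
move=> mn _ [x Bx <-]; exists (iter (n - m) f x); first exact: trapped_iter.
by rewrite -iterD subnKC.
Qed.

Lemma trapped_bigcap_neq0 : \bigcap_n F n !=set0.
Proof.
apply/set0P/negP => /eqP F0.
have [N _ /(_ N (leqnn N)) FN0] : \forall n \near \oo, F n `<=` set0.
  (* Cantor's argument: if the intersection were empty, the empty open set would contain it, hence
     also some [F n]. *)
  apply: (compact_bigcap_sub_near B) => //.
  - exact: open0.
  - exact: trapped_image_sub.
  - exact: trapped_image_closed.
  - exact: trapped_image_decr.
  - by rewrite F0.
by have [x Bx] := B_neq0; apply: (FN0 (iter N f x)); exists x.
Qed.

Lemma trapped_bigcap_compact : compact (\bigcap_n F n).
Proof.
apply: (subclosed_compact _ B_compact).
  by apply: closed_bigI => n _; exact: trapped_image_closed.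
by move=> x /(_ 0 I); exact: trapped_image_sub.
Qed.

Lemma trapped_bigcap_attracts x : B x ->
  dist_to_set (\bigcap_n F n) (iter n f x) @[n --> \oo] --> (0 : R).
Proof.
move=> Bx; apply/cvgrPdist_lt => e e0.
(* [U] is an open set around the intersection, all of whose points are within [e] of it; the sets
   [F n] eventually enter it, and [F n] contains the n-th iterate of [x]. *)
pose U : set M := \bigcup_(z in \bigcap_n F n) (ball z e)°.
have oU : open U by apply: bigcup_open => z _; exact: open_interior.
have : \forall n \near \oo, F n `<=` U.
  apply: (compact_bigcap_sub_near B) => //.
  - exact: trapped_image_sub.
  - exact: trapped_image_closed.
  - exact: trapped_image_decr.
  - by move=> z Fz; exists z => //; exact: nbhsx_ballx.
apply: filterS => n /(_ (iter n f x)) FU.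
have [|z Fz /interior_subset zx] := FU; first by exists x.
rewrite sub0r normrN ger0_norm; first exact: dist_to_set_lt_near zx.
by apply: dist_to_set_ge0; exact: trapped_bigcap_neq0.
Qed.

End TrappingRegion.

(** * Absolute values and compactness of the valuation ring *)

Lemma exists_exprn_gt {R : realType} (r C : R) : 1 < r ->
  exists n, C < r ^+ n.
Proof.
move=> r1.
have r0 : 0 < r := lt_trans ltr01 r1.
have /cvgrPdist_lt : (fun n => r^-1 ^+ n) @ \oo --> (0 : R).
  by apply: cvg_expr; rewrite gtr0_norm ?invr_gt0// invf_lt1.
(* [C] may be nonpositive, so the powers of [r^-1] are compared with the inverse of a positive
   number exceeding [C]. *)
have C0 : 0 < `|C| + 1 by rewrite ltr_wpDl.
move=> /(_ (`|C| + 1)^-1); rewrite invr_gt0 => /(_ C0)[n _ /(_ n (leqnn n))].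
rewrite /= sub0r normrN gtr0_norm ?exprn_gt0 ?invr_gt0// exprVn.
rewrite ltf_pV2 ?posrE ?exprn_gt0// => Cr; exists n.
by rewrite (le_lt_trans _ Cr)// (le_trans (ler_norm C))// lerDl.
Qed.

Section AbsLemmas.
Variables (R : realType) (K : fieldType) (v : nonArchAbs R K).

Lemma absvX x n : v (x ^+ n) = v x ^+ n.
Proof. by elim: n => [|n IH]; rewrite ?absv1// !exprS absvM IH. Qed.

(** The isosceles principle: writing [y] as [- x + (x + y)], the ultrametric bound on [v y] cannot
    be attained by the smaller [v x]. *)
Lemma absvD_lt x y : v x < v y -> v (x + y) = v y.
Proof.
move=> xy; apply/eqP; rewrite eq_le; apply/andP; split.
  by rewrite (le_trans (absv_ultra v _ _))// (max_idPr (ltW xy)).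
have := absv_ultra v (- x) (x + y); rewrite addKr absvN le_max.
by rewrite leNgt xy.
Qed.

Lemma absvD_le x y r : v x <= r -> v y <= r -> v (x + y) <= r.
Proof.
by move=> xr yr; rewrite (le_trans (absv_ultra v _ _))// ge_max xr.
Qed.

Lemma val_ring_closed : closed [set x : valued v | v x <= 1].
Proof.
move=> x /(_ _ (nbhsx_ballx x 1 ltr01))[y [y1]].
rewrite ballEmdist /= => xy.
by rewrite -[x](subrK (y : K)); apply: absvD_le => //; exact: ltW.
Qed.

(** A power of [c] scales the valuation ring into a compact neighborhood [U] of 0. Scaling [U] back
    gives a compact set containing the ring, which is closed. *)
Lemma val_ring_compact (c : K) : 0 < v c < 1 ->
  locally_compact_abs v -> compact [set x : valued v | v x <= 1].
Proof.
move=> /andP[c0 c1] /(_ 0 I)[U nU [Ucpt _]].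
have [e /= e0 eU] : nbhs_ball (0 : valued v) U.
  by apply/nbhs_ballP; move: nU; rewrite /within /=; apply: filterS => x; exact.
have [n en] : exists n, e^-1 < (v c)^-1 ^+ n.
  by apply: exists_exprn_gt; rewrite invf_gt1.
have cn0 : 0 < v (c ^+ n) by rewrite absvX exprn_gt0.
have cne : v (c ^+ n) < e.
  by move: en; rewrite exprVn ltf_pV2 ?posrE ?exprn_gt0// absvX.
have cn_neq0 : c ^+ n != 0 by rewrite -(absv_eq0 v) gt_eqF.
pose g : valued v -> valued v := fun x => (c ^+ n)^-1 * x.
have gU : compact (g @` U).
  apply: continuous_compact => //.
  apply: (@lipschitz_within_continuous _ _ _ _ _ (v (c ^+ n))^-1).
    by rewrite invr_gt0.
  by move=> x y _ _; rewrite {1}/mdist /= /valued_dist -mulrBr absvM absvV.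
apply: subclosed_compact gU _; first exact: val_ring_closed.
move=> x x1; exists (c ^+ n * x); last by rewrite /g mulKf.
apply: eU; rewrite ballEmdist /= {1}/mdist /= /valued_dist sub0r absvN absvM.
by rewrite (le_lt_trans _ cne)// ler_piMr// ltW.
Qed.

End AbsLemmas.

(** * The Henon map, its unit ball and its escaping points *)

Section Henon.
Variables (R : realType) (K : fieldType) (v : nonArchAbs R K) (a b : K).
Hypothesis Hab : H_II_plus v a b.

Local Notation phi := (henon v a b).
Local Notation psi := (henon_inv v a b).
Local Notation B := (unit_ball v).
Local Notation J := (henon_J v a b).

Let a1 : v a <= 1. Proof. by case: Hab. Qed.
Let b1 : v b < 1. Proof. by case: Hab => _ /andP[]. Qed.
Let vb0 : 0 < v b. Proof. by case: Hab => _ /andP[]. Qed.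
Let b0 : b != 0. Proof. by rewrite -(absv_eq0 v) gt_eqF. Qed.

Lemma unit_ballP (z : plane v) : B z <-> v z.1 <= 1 /\ v z.2 <= 1.
Proof. by rewrite /unit_ball /= /plane_norm ge_max; split=> /andP. Qed.

Lemma unit_ball_compact : locally_compact_abs v -> compact B.
Proof.
move=> vlc.
have -> : B = [set x : valued v | v x <= 1] `*` [set x : valued v | v x <= 1].
  by apply/seteqP; split=> z /unit_ballP.
(* Since [0 < v b < 1], [b] itself can serve as the scaling element. *)
by apply: compact_setX; apply: (val_ring_compact _ _ v b); rewrite ?vb0.
Qed.

Lemma unit_ball_open : open B.
Proof.
rewrite openE => z /unit_ballP[z1 z2].
(* By the ultrametric inequality, radius 1 works at every point of the ball. *)
apply/nbhs_ballP; exists 1 => //= w; rewrite ballEmdist /= gt_max.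
move=> /andP[/ltW zw1 /ltW zw2]; apply/unit_ballP; split.
  by rewrite -[w.1](subrK (z.1 : K)) absvD_le// -opprB absvN.
by rewrite -[w.2](subrK (z.2 : K)) absvD_le// -opprB absvN.
Qed.

Lemma henon_unit_ball z : B z -> B (phi z).
Proof.
move=> /unit_ballP[x1 y1]; apply/unit_ballP; split=> //=.
apply: absvD_le; first apply: absvD_le => //.
  by rewrite absvM mulr_ile1 ?absv_ge0// ltW.
by rewrite absvN absvX expr_le1 ?absv_ge0.
Qed.

Lemma henon_nonexpansive z w : B z -> B w -> mdist (phi z) (phi w) <= mdist z w.
Proof.
move=> /unit_ballP[x1 _] /unit_ballP[x1' _].
rewrite !plane_mdistE /plane_norm /= ge_max.
apply/andP; split; last by rewrite le_max lexx.
(* The quadratic part factors as a difference of squares; the factors [b] and [z.1 + w.1] both have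
   absolute value at most 1. *)
have -> : a + b * z.2 - z.1 ^+ 2 - (a + b * w.2 - w.1 ^+ 2) =
    b * (z.2 - w.2) - (z.1 + w.1) * (z.1 - w.1) :> K by ring.
apply: absvD_le; rewrite ?absvN absvM le_max; apply/orP; [right|left].
  by rewrite ler_piMl ?absv_ge0 ?ltW.
by rewrite ler_piMl ?absv_ge0// absvD_le.
Qed.

(** When [|x| > 1] and [|y| <= |x|], the term [x ^+ 2] strictly dominates [a + b * y], so the new
    first coordinate has absolute value [|x|^2] and both conditions persist. *)
Lemma henon_escape (z : plane v) : 1 < v z.1 -> v z.2 <= v z.1 ->
  forall n, v z.1 ^+ n.+1 <= v (iter n phi z).1 /\
            v (iter n phi z).2 <= v (iter n phi z).1.
Proof.
move=> x1 yx; elim=> [|n [IH1 IH2]]; first by rewrite expr1.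
rewrite iterS; set w := iter n phi z in IH1 IH2 *.
have w1 : v z.1 <= v w.1 by rewrite (le_trans _ IH1)// ler_eXnr// ltW.
have w_gt1 : 1 < v w.1 := lt_le_trans x1 w1.
have w_gt0 : 0 < v w.1 := lt_trans ltr01 w_gt1.
have ww2 : v w.1 < v (- w.1 ^+ 2) by rewrite absvN absvX expr2 ltr_pMr.
rewrite /= absvD_lt; last first.
  apply: (le_lt_trans _ ww2); apply: absvD_le.
    by rewrite (le_trans a1)// ltW.
  by rewrite absvM (le_trans _ IH2)// ler_piMl ?absv_ge0// ltW.
split; last exact: ltW.
rewrite absvN absvX expr2 exprS ler_pM ?absv_ge0//.
by rewrite exprn_ge0 ?absv_ge0.
Qed.

(** Mirror image with the coordinates exchanged: [y ^+ 2] dominates [- a + x], and dividing by [b]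
    only enlarges the result. *)
Lemma henon_inv_escape (z : plane v) : 1 < v z.2 -> v z.1 <= v z.2 ->
  forall n, v z.2 ^+ n.+1 <= v (iter n psi z).2 /\
            v (iter n psi z).1 <= v (iter n psi z).2.
Proof.
move=> y1 xy; elim=> [|n [IH1 IH2]]; first by rewrite expr1.
rewrite iterS; set w := iter n psi z in IH1 IH2 *.
have w1 : v z.2 <= v w.2 by rewrite (le_trans _ IH1)// ler_eXnr// ltW.
have w_gt1 : 1 < v w.2 := lt_le_trans y1 w1.
have w_gt0 : 0 < v w.2 := lt_trans ltr01 w_gt1.
have ww2 : v w.2 < v (w.2 ^+ 2) by rewrite absvX expr2 ltr_pMr.
have le2 : v (w.2 ^+ 2) <= v (b^-1 * (- a + w.1 + w.2 ^+ 2)).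
  rewrite [leRHS]absvM absvD_lt; last first.
    apply: (le_lt_trans _ ww2); apply: absvD_le => //.
    by rewrite absvN (le_trans a1)// ltW.
  by rewrite ler_peMl ?absv_ge0// absvV invf_ge1// ltW.
split; last by rewrite /= (le_trans (ltW ww2)).
rewrite /= (le_trans _ le2)// absvX expr2 exprS ler_pM ?absv_ge0//.
by rewrite exprn_ge0 ?absv_ge0.
Qed.

(** Outside [B] the larger coordinate exceeds 1 in absolute value. If it is the first, the forward
    orbit is unbounded; if the second, the backward one is. *)
Lemma bounded_orbit_unit_ball (C : R) (z : plane v) :
  (forall n, plane_norm (iter n phi z) <= C) ->
  (forall n, plane_norm (iter n psi z) <= C) -> B z.
Proof.
move=> fwd bwd; apply: contrapT => /unit_ballP/not_andP nB.
have [yx|/ltW xy] := leP (v z.2) (v z.1).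
  have x1 : 1 < v z.1.
    by case: nB => /negP; rewrite -ltNge// => /lt_le_trans; apply.
  have [n Cn] := exists_exprn_gt (v z.1) C x1.
  have [le1 _] := henon_escape z x1 yx n.
  have := fwd n; rewrite ge_max => /andP[+ _].
  apply/negP; rewrite -ltNge (lt_le_trans Cn)// (le_trans _ le1)//.
  by rewrite ler_eXn2l// leqnSn.
have y1 : 1 < v z.2.
  by case: nB => /negP; rewrite -ltNge// => /lt_le_trans; apply.
have [n Cn] := exists_exprn_gt (v z.2) C y1.
have [le1 _] := henon_inv_escape z y1 xy n.
have := bwd n; rewrite ge_max => /andP[_].
apply/negP; rewrite -ltNge (lt_le_trans Cn)// (le_trans _ le1)//.
by rewrite ler_eXn2l// leqnSn.
Qed.

Lemma iter_henonK n : cancel (iter n phi) (iter n psi).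
Proof.
by elim: n => // n IH z; rewrite iterSr iterS (henonK _ b0) IH.
Qed.

Lemma iter_henon_invK n : cancel (iter n psi) (iter n phi).
Proof.
by elim: n => // n IH z; rewrite iterSr iterS (henon_invK _ b0) IH.
Qed.

Lemma henon_J_bigcap : J = \bigcap_n (iter n phi @` B).
Proof.
apply/seteqP; split=> [z [C zC] n _|z zB].
  have fwd m : plane_norm (iter m phi z) <= C by apply: zC; exists (Posz m).
  have bwd m : plane_norm (iter m psi z) <= C.
    by case: m => [|m]; apply: zC; [exists (Posz 0)|exists (Negz m)].
  (* The orbit of [iter n psi z] is that of [z] with times shifted, so the same bound [C] puts this
     preimage in [B]. *)
  exists (iter n psi z); last exact: iter_henon_invK.
  apply: (bounded_orbit_unit_ball C) => m; last by rewrite -iterD; exact: bwd.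
  have [nm|/ltnW mn] := leqP n m.
    by rewrite -(subnK nm) iterD iter_henon_invK; exact: fwd.
  by rewrite -(subnKC mn) iterD iter_henon_invK; exact: bwd.
exists 1 => _ [[n|n] _ <-] /=.
  apply: (trapped_iter _ _ phi B henon_unit_ball).
  by have [w Bw <-] := zB 0%N I.
(* [Negz n] stands for time [-(n+1)], so membership in the image of index [n.+1] is what returns the
   point to [B]. *)
by have [w Bw <-] := zB n.+1 I; rewrite -iterS iter_henonK.
Qed.

Lemma henon_J_invariant : phi @` J = J.
Proof.
rewrite henon_J_bigcap; apply/seteqP; split=> [_ [z zB <-] n _|z zB].
  have [w Bw <-] := zB n I; exists (phi w); first exact: henon_unit_ball.
  by rewrite -iterSr iterS.
exists (psi z); last exact: henon_invK.
(* One extra iterate is taken because [psi] cancels one [phi]. *)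
move=> n _; have [w Bw <-] := zB n.+1 I.
by exists w => //; rewrite iterS henonK.
Qed.

(* The preimage of [(a + 1, 0)] is [(0, 1 / b)], which is not in the ball. *)
Lemma unit_ball_not_sub_henon_J : ~ (B `<=` J).
Proof.
move=> /(_ ((a + 1, 0) : plane v)); rewrite henon_J_bigcap => BJ.
have /BJ/(_ 1%N I)[[x y] /unit_ballP[/= _ y1]] : B (a + 1, 0).
  by apply/unit_ballP; rewrite /= absv0 absvD_le ?absv1.
rewrite /henon /= => -[+ x0]; rewrite x0 expr0n subr0 => /addrI by1.
have : v (b * y) = 1 by rewrite by1 absv1.
by apply/eqP; rewrite lt_eqF// absvM (le_lt_trans _ b1)// ler_piMr ?absv_ge0.
Qed.

Lemma henon_attracted_unit_ball :
  locally_compact_abs v -> attracted_nbhd phi J B.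
Proof.
move=> vlc; split; first exact: unit_ball_open.
  split; last exact: unit_ball_not_sub_henon_J.
  by rewrite henon_J_bigcap => z /(_ 0%N I)[w Bw <-].
rewrite henon_J_bigcap; apply: trapped_bigcap_attracts.
- exact: unit_ball_compact.
- by exists (0, 0); apply/unit_ballP; rewrite absv0.
- exact: henon_unit_ball.
- exact: henon_nonexpansive.
Qed.

End Henon.

Theorem theorem4p3 (R : realType) (K : fieldType) (v : nonArchAbs R K)
    (v_nontrivial : nontrivial_abs v)
    (v_complete : complete_abs v)
    (v_locally_compact : locally_compact_abs v)
    (residue_odd : exists2 p : nat, odd p & p \in [pchar (residue_field v)])
    (a b : K) (Hab : H_II_plus v a b) :
  is_attractor (henon v a b) (henon_J v a b) /\
  unit_ball v `<=` basin (henon v a b) (henon_J v a b).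
Proof.
(* The unit ball serves both as the open set required of an attractor and as a member of the union
   defining the basin. *)
have Bnbhd := henon_attracted_unit_ball _ _ _ _ _ Hab v_locally_compact.
split; last by move=> z Bz; exists (unit_ball v).
split; last by exists (unit_ball v).
- rewrite henon_J_bigcap//; apply: trapped_bigcap_neq0.
  + exact: unit_ball_compact Hab _.
  + by exists (0, 0); apply/unit_ballP; rewrite absv0.
  + exact: henon_unit_ball.
  + exact: henon_nonexpansive.
- rewrite henon_J_bigcap//; apply: trapped_bigcap_compact.
  + exact: unit_ball_compact Hab _.
  + exact: henon_unit_ball.
  + exact: henon_nonexpansive.
- exact: henon_J_invariant.
Qed.
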